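(* For all pairs $(A,B)$ of non-negative, smooth functions supported in $[-D,D]^3$ and all $\lambda>0$ there exists a Brill-Lindquist-Riemann sum for $(A,B)$ with shallow wells for which $\mathscr C(\alpha,A),\ \mathscr C(\beta,B)\le\lambda D$.
   Context: Let $D>0$. For each $n\in\mathbb N$ subdivide $[-D,D]^3\subset\mathbb R^3$ into $(2n)^3$ boxes of side $D/n$, with centers $p_{i,n}$. A Brill-Lindquist-Riemann sum for $(A,B)$ is determined by a family of parameters $\alpha_{i,n},\beta_{i,n}\ge0$ (one pair for each box and each $n$) with $$\mathscr C(\alpha,A):=\sup_{i,n}n^4|\alpha_{i,n}-A(p_{i,n})(D/n)^3|<\infty,\qquad\mathscr C(\beta,B):=\sup_{i,n}n^4|\beta_{i,n}-B(p_{i,n})(D/n)^3|<\infty.$$ (The associated metrics are $g_n=(\chi_n\psi_n)^2g_{\mathbb E}$ with $\chi_n(x)=1+\sum_i\frac{\alpha_{i,n}}{|x-p_{i,n}|}$, $\psi_n(x)=1+\sum_i\frac{\beta_{i,n}}{|x-p_{i,n}|}$.) Put $\mathcal P_{n,*}=\{p_{i,n}:\alpha_{i,n}+\beta_{i,n}\ne0\}$, $\mathcal P_{n,**}=\{p_{i,n}:\alpha_{i,n}\beta_{i,n}\ne0\}$, and let $\ell_n:=\max\frac1D(\alpha_{i,n}+\beta_{i,n})|\ln(\alpha_{i,n}\beta_{i,n}/D^2)|$, the maximum being over $i$ with $p_{i,n}\in\mathcal P_{n,*}$, if $\mathcal P_{n,**}=\mathcal P_{n,*}$ (a maximum over the empty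 set being $0$), and $\ell_n:=\infty$ otherwise. The sequence has deep wells if $\mathcal P_{n,**}\neq\mathcal P_{n,*}$ for some $n$ or if $(\ell_n)$ is unbounded; otherwise it has no deep wells. It has shallow wells if it has no deep wells and $\lim_{n\to\infty}\ell_n=0$. *)

(* Defs.v *)
From mathcomp Require Import all_boot all_order all_algebra.
From mathcomp Require Import all_classical all_reals all_analysis.
Import Order.TTheory GRing.Theory Num.Theory.
Import numFieldNormedType.Exports.

Set Implicit Arguments.
Unset Strict Implicit.
Unset Printing Implicit Defensive.

Local Open Scope classical_set_scope.
Local Open Scope ring_scope.

Section Smooth.
Variables (R : realType) (m : nat).
Implicit Type f : 'rV[R]_m -> R.

Definition partial (j : 'I_m) f : 'rV[R]_m -> R :=
  fun x => 'D_(delta_mx 0 j) f x.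

Definition partials (s : seq 'I_m) f : 'rV[R]_m -> R := foldr partial f s.

(* C^oo: partial derivatives of all orders exist and are continuous.
   Existence is a separate clause because 'D_v is total. *)
Definition smooth f : Prop := forall s : seq 'I_m,
  continuous (partials s f) /\
  forall (j : 'I_m) (x : 'rV[R]_m), derivable (partials s f) x (delta_mx 0 j).

Definition supported_in (K : set 'rV[R]_m) f : Prop :=
  closure [set x | f x != 0] `<=` K.

End Smooth.

Definition cube (R : realType) (D : R) : set 'rV[R]_3 :=
  [set x | forall j, - D <= x 0 j <= D].

(* There is no box for n = 0, so every condition below on the n-th family is
   vacuous there: the index n effectively ranges over the positive integers. *)
Definition box (n : nat) := {ffun 'I_3 -> 'I_(2 * n)}.

Definition center (R : realType) (D : R) (n : nat) (i : box n) : 'rV[R]_3 :=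
  \row_j (- D + (i j)%:R * (D / n%:R) + D / n%:R / 2).

Section BrillLindquistRiemann.
Variables (R : realType) (D : R).
Implicit Types (A B : 'rV[R]_3 -> R) (alpha beta : forall n, box n -> R).

(* The constant C(alpha, A), as an extended real. *)
Definition discrepancy alpha A : \bar R :=
  ereal_sup [set e : \bar R | exists (n : nat) (i : box n),
    e = (n%:R ^+ 4 *
         `|alpha n i - A (center D i) * (D / n%:R) ^+ 3|)%:E].

Record BLR_sum A B := BLRSum {
  alpha : forall n, box n -> R ;
  beta : forall n, box n -> R ;
  alpha_ge0 : forall n (i : box n), 0 <= alpha i ;
  beta_ge0 : forall n (i : box n), 0 <= beta i ;
  alpha_discrepancy : (discrepancy alpha A < +oo)%E ;
  beta_discrepancy : (discrepancy beta B < +oo)%E }.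

(* The matrix norm of MathComp-Analysis is the sup norm. *)
Definition euclidean_norm (x : 'rV[R]_3) : R :=
  Num.sqrt (\sum_j x 0 j ^+ 2).

Definition potential (a : forall n, box n -> R) (n : nat) (x : 'rV[R]_3) : R :=
  1 + \sum_(i : box n) a n i / euclidean_norm (x - center D i).

Section Wells.
Variables (A B : 'rV[R]_3 -> R) (S : BLR_sum A B).

(* The metric g_n = (chi_n psi_n)^2 g_E as a Gram matrix, meaningful for x off
   [sources n]; the sequence (g_n) is determined by the parameters in S. *)
Definition metric (n : nat) (x : 'rV[R]_3) : 'M[R]_3 :=
  ((potential (alpha S) n x * potential (beta S) n x) ^+ 2)%:M.

(* P_{n,*} and P_{n,**} *)
Definition sources (n : nat) : set 'rV[R]_3 :=
  [set center D i | i in [set i : box n | alpha S i + beta S i != 0]].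

Definition double_sources (n : nat) : set 'rV[R]_3 :=
  [set center D i | i in [set i : box n | alpha S i * beta S i != 0]].

(* All terms of the maximum are nonnegative when D > 0, so the default value 0
   only matters when there are no sources. *)
Definition well_depth (n : nat) : \bar R :=
  if `[< double_sources n = sources n >] then
    (\big[Num.max/0]_(i : box n | center D i \in sources n)
       (D^-1 * (alpha S i + beta S i) *
        `|ln (alpha S i * beta S i / D ^+ 2)|))%:E
  else +oo%E.

Definition deep_wells : Prop :=
  (exists n, double_sources n <> sources n) \/
  ~ (exists M : R, forall n, (well_depth n <= M%:E)%E).

Definition shallow_wells : Prop :=
  ~ deep_wells /\ well_depth n @[n --> \oo] --> 0%E.

End Wells.
End BrillLindquistRiemann.

(* Main.v *)
Require Import Defs.
From mathcomp Require Import all_boot all_order all_algebra.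
From mathcomp Require Import all_classical all_reals all_analysis.
From mathcomp Require Import ring lra.
Import Order.TTheory GRing.Theory Num.Theory.
Import numFieldNormedType.Exports.

Set Implicit Arguments.
Unset Strict Implicit.
Unset Printing Implicit Defensive.

Local Open Scope classical_set_scope.
Local Open Scope ring_scope.

(** Raise every Riemann weight by [lambda D / n^4]: all the weights become
    positive and both discrepancies are at most [lambda D]. The weights then lie
    between [c / n^4] and [C / n^3], so the logarithm of a product of two of them
    grows at most like [8 ln n], which the prefactor of order [n^-3] beats. *)

Lemma compact_cube (R : realType) (D : R) : compact (cube D).
Proof.
have -> : cube D = [set v : 'rV[R]_3 | forall i, (`[- D, D]%classic : set R) (v ord0 i)].
  by apply/seteqP; split => v /= hv i; have := hv i; rewrite in_itv.
by apply: (@rV_compact _ _ (fun=> _)) => _; exact: segment_compact.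
Qed.

Lemma box_gt0 (n : nat) : box n -> (0 < n)%N.
Proof. by move=> i; have := ltn_ord (i ord0); case: n i => // i; rewrite muln0. Qed.

Lemma center_in_cube (R : realType) (D : R) (n : nat) (i : box n) :
  0 <= D -> cube D (Defs.center D i).
Proof.
move=> D0 j; rewrite mxE.
have hi := ltn_ord (i j).
have nR : (0 : R) < n%:R by rewrite ltr0n (box_gt0 i).
set h := D / n%:R.
have h0 : 0 <= h by rewrite divr_ge0 // ltW.
have nh : n%:R * h = D by rewrite mulrC divfK // gt_eqF.
have ih0 : 0 <= (i j)%:R * h by rewrite mulr_ge0.
(* The [j]-th coordinate of the center is [-D + (i j + 1/2) h]. The index bound in the form
   [i j + 1 <= 2n], together with [n h = D], leaves room for the half step. *)
have ih1 : ((i j)%:R + 1) * h <= 2 * n%:R * h.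
  by apply: ler_wpM2r => //; rewrite natr1 -natrM ler_nat.
by apply/andP; split; lra.
Qed.

Lemma continuous_le_on_compact (R : realType) (T : topologicalType) (K : set T)
    (f : T -> R) :
  compact K -> continuous f -> exists M, forall x, K x -> f x <= M.
Proof.
move=> cK cf; have [->|/set0P K0] := eqVneq K set0; first by exists 0.
have [c _ hc] := compact_EVT_max K0 cK (continuous_subspaceT cf).
by exists (f c) => x Kx; apply: hc; rewrite inE.
Qed.

Lemma norm_ln_le (R : realType) (a x b : R) :
  0 < a -> a <= x <= b -> `|ln x| <= `|ln a| + `|ln b|.
Proof.
move=> a0 /andP[ax xb].
have x0 := lt_le_trans a0 ax; have b0 := lt_le_trans x0 xb.
have lax : ln a <= ln x by rewrite ler_ln.
have lxb : ln x <= ln b by rewrite ler_ln.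
have := ler_norm (ln b); have := ler_norm (- ln a); rewrite normrN => ha hb.
have := normr_ge0 (ln a); have := normr_ge0 (ln b).
by rewrite ler_norml => ? ?; apply/andP; split; lra.
Qed.

(** The quotient [a b / D^2] lies between [(c/D)^2 / n^8] and [(C/D)^2], so its logarithm is at most
    a constant plus [8 ln n] in absolute value. The crude bound [ln n <= n] is enough: a factor of
    order [n] against a sum [a + b] of order [n^-2] still gives [1/n], with a constant independent
    of [a], [b] and [n]. *)
Lemma well_term_le (R : realType) (D c C a b : R) (n : nat) :
  0 < D -> 0 < c -> (0 < n)%N ->
  c / n%:R ^+ 4 <= a <= C / n%:R ^+ 3 ->
  c / n%:R ^+ 4 <= b <= C / n%:R ^+ 3 ->
  D^-1 * (a + b) * `|ln (a * b / D ^+ 2)| <=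
  D^-1 * (2 * C) * (`|ln ((c / D) ^+ 2)| + `|ln ((C / D) ^+ 2)| + 8) / n%:R.
Proof.
move=> D0 c0 n0 /andP[la ua] /andP[lb ub].
have nR : (1 : R) <= n%:R by rewrite ler1n.
have n0R : (0 : R) < n%:R by rewrite ltr0n.
have low0 : 0 < c / n%:R ^+ 4 by rewrite divr_gt0 // exprn_gt0.
have a0 := lt_le_trans low0 la; have b0 := lt_le_trans low0 lb.
have up0 := lt_le_trans a0 ua.
(* The sign of [C] comes from [0 < a <= C / n^3]. *)
have C0 : 0 < C by move: up0; rewrite pmulr_lgt0 // invr_gt0 exprn_gt0.
have upC : C / n%:R ^+ 3 <= C.
  by rewrite ler_pdivrMr ?exprn_gt0 // ler_peMr ?exprn_ege1 // ltW.
set F := `|_| + `|_|.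
have F0 : 0 <= F by rewrite addr_ge0.
have lnE : `|ln (a * b / D ^+ 2)| <= F + 8 * n%:R.
  have cD : 0 < (c / D) ^+ 2 by rewrite exprn_gt0 // divr_gt0.
  have n8 : (0 : R) < n%:R ^+ 8 by rewrite exprn_gt0.
  have hlow : 0 < (c / D) ^+ 2 / n%:R ^+ 8 by rewrite divr_gt0.
  (* The lower endpoint keeps its factor [n^-8], the source of [8 ln n]; the upper one is relaxed to
     [(C/D)^2] by [C / n^3 <= C], so that it is free of [n]. *)
  apply: (@le_trans _ _ (`|ln ((c / D) ^+ 2 / n%:R ^+ 8)| + `|ln ((C / D) ^+ 2)|)).
    apply: norm_ln_le => //; apply/andP; split.
      have -> : (c / D) ^+ 2 / n%:R ^+ 8
          = (c / n%:R ^+ 4) * (c / n%:R ^+ 4) / D ^+ 2.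
        by field; rewrite !gt_eqF.
      by rewrite ler_pM2r ?invr_gt0 ?exprn_gt0 // ler_pM // ltW.
    have -> : (C / D) ^+ 2 = C * C / D ^+ 2 by field; rewrite gt_eqF.
    rewrite ler_pM2r ?invr_gt0 ?exprn_gt0 //.
    by apply: ler_pM; rewrite ?(ltW a0) ?(ltW b0) //;
       [exact: le_trans ua _ | exact: le_trans ub _].
  rewrite ln_div ?posrE // (lnXn 8) //.
  have ln0 : 0 <= ln (n%:R : R) by rewrite ln_ge0.
  have lnn : ln (n%:R : R) <= n%:R by rewrite ltW // ln_sublinear.
  have := ler_normB (ln ((c / D) ^+ 2)) (ln (n%:R : R) *+ 8).
  rewrite (@ger0_norm _ (ln _ *+ 8)) ?mulrn_wge0 // /F -[ln _ *+ 8]mulr_natl.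
  by move=> ?; lra.
have lnE' : `|ln (a * b / D ^+ 2)| <= (F + 8) * n%:R.
  by apply: le_trans lnE _; rewrite [leRHS]mulrDl lerD // ler_peMr.
have abE : a + b <= 2 * C / n%:R ^+ 2.
  apply: (@le_trans _ _ (2 * C / n%:R ^+ 3)); first by lra.
  rewrite ler_pM2l; last by lra.
  by rewrite lef_pV2 ?posrE ?exprn_gt0 // ler_weXn2l.
have -> : D^-1 * (2 * C) * (F + 8) / n%:R
    = D^-1 * (2 * C / n%:R ^+ 2) * ((F + 8) * n%:R).
  by field; rewrite !gt_eqF.
apply: ler_pM => //; first by rewrite mulr_ge0 ?invr_ge0 ?addr_ge0 // ltW.
by rewrite ler_pM2l ?invr_gt0.
Qed.

(** The shift is the largest that the bound on the discrepancy allows: multiplied by [n^4] it is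
    exactly [lambda D]. *)
Definition lifted_weight (R : realType) (D lambda : R) (A : 'rV[R]_3 -> R)
    (n : nat) (i : box n) : R :=
  A (Defs.center D i) * (D / n%:R) ^+ 3 + lambda * D / n%:R ^+ 4.

Section LiftedWeight.
Variables (R : realType) (D lambda : R) (A : 'rV[R]_3 -> R).
Hypotheses (D_gt0 : 0 < D) (lambda_gt0 : 0 < lambda).
Hypothesis (A_ge0 : forall x, 0 <= A x).

Lemma lifted_weight_ge (n : nat) (i : box n) :
  lambda * D / n%:R ^+ 4 <= lifted_weight D lambda A i.
Proof. by rewrite lerDr mulr_ge0 // exprn_ge0 // divr_ge0 // ltW. Qed.

Lemma lifted_weight_gt0 (n : nat) (i : box n) :
  0 < lifted_weight D lambda A i.
Proof.
apply: lt_le_trans (lifted_weight_ge i).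
apply: divr_gt0; first exact: mulr_gt0.
by rewrite exprn_gt0 // ltr0n (box_gt0 i).
Qed.

(** Since [n >= 1], the shift of order [n^-4] is absorbed into the order [n^-3] of the Riemann
    weight. *)
Lemma lifted_weight_le (M : R) (n : nat) (i : box n) :
  A (Defs.center D i) <= M ->
  lifted_weight D lambda A i <= (M * D ^+ 3 + lambda * D) / n%:R ^+ 3.
Proof.
move=> AM; have n0 := box_gt0 i.
have n0R : (0 : R) < n%:R by rewrite ltr0n.
have -> : (M * D ^+ 3 + lambda * D) / n%:R ^+ 3
    = M * (D / n%:R) ^+ 3 + lambda * D / n%:R ^+ 3.
  by field; rewrite gt_eqF.
apply: lerD; first by rewrite ler_wpM2r // exprn_ge0 // divr_ge0 // ltW.
rewrite ler_pM2l ?mulr_gt0 // lef_pV2 ?posrE ?exprn_gt0 //.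
by rewrite ler_weXn2l // ler1n.
Qed.

Lemma discrepancy_lifted_weight :
  (discrepancy D (lifted_weight D lambda A) A <= (lambda * D)%:E)%E.
Proof.
apply: ge_ereal_sup => _ [n [i ->]].
have n4 : (0 : R) < n%:R ^+ 4 by rewrite exprn_gt0 // ltr0n (box_gt0 i).
rewrite lee_fin /lifted_weight [X in `|X|]addrAC subrr add0r ger0_norm; last first.
  by rewrite divr_ge0 ?mulr_ge0 // ltW.
by rewrite mulrC divfK // gt_eqF.
Qed.

End LiftedWeight.

(** With positive parameters neither the sums nor the products vanish, so both sets consist of all
    the centers. *)
Lemma eq_sources (R : realType) (D : R) (A B : 'rV[R]_3 -> R)
    (S : BLR_sum D A B) (n : nat) :
  (forall i : box n, 0 < alpha S i) -> (forall i : box n, 0 < beta S i) ->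
  double_sources S n = sources S n.
Proof.
move=> a0 b0; rewrite /double_sources /sources; congr (_ @` _).
by apply/seteqP; split => i _ /=; rewrite gt_eqF ?addr_gt0 ?mulr_gt0.
Qed.

(** A single constant [K] bounds every depth by [K / n]. This gives both the boundedness that
    excludes deep wells and, by squeezing, the limit 0. *)
Lemma shallow_wells_of_bounds (R : realType) (D : R) (A B : 'rV[R]_3 -> R)
    (S : BLR_sum D A B) (c C : R) :
  0 < D -> 0 < c ->
  (forall n (i : box n), c / n%:R ^+ 4 <= alpha S i <= C / n%:R ^+ 3) ->
  (forall n (i : box n), c / n%:R ^+ 4 <= beta S i <= C / n%:R ^+ 3) ->
  shallow_wells S.
Proof.
move=> D0 c0 ha hb.
have low n (i : box n) : 0 < c / n%:R ^+ 4.
  by rewrite divr_gt0 // exprn_gt0 // ltr0n (box_gt0 i).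
have a0 n (i : box n) : 0 < alpha S i.
  by have /andP[h _] := ha n i; exact: lt_le_trans (low n i) h.
have b0 n (i : box n) : 0 < beta S i.
  by have /andP[h _] := hb n i; exact: lt_le_trans (low n i) h.
have srcE n := eq_sources (a0 n) (b0 n).
(* The maximum with 0 makes [K] nonnegative without exhibiting a box to show [0 < C]. Nonnegativity
   is required because the maximum defining the depth starts from 0. *)
pose K := Num.max 0
  (D^-1 * (2 * C) * (`|ln ((c / D) ^+ 2)| + `|ln ((C / D) ^+ 2)| + 8)).
have K0 : 0 <= K by rewrite le_max lexx.
have depth_le n : (well_depth S n <= (K / n%:R)%:E)%E.
  rewrite /well_depth asboolT // lee_fin; apply: bigmax_le => [|i _].
    by rewrite divr_ge0.
  apply: le_trans (well_term_le D0 c0 (box_gt0 i) (ha n i) (hb n i)) _.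
  by rewrite ler_wpM2r ?invr_ge0 // le_max lexx orbT.
have depth_ge0 n : (0 <= well_depth S n)%E.
  by rewrite /well_depth asboolT // lee_fin; exact: bigmax_ge_id.
split.
  case=> [[n]|]; first by rewrite srcE.
  apply; exists K => n; apply: le_trans (depth_le n) _; rewrite lee_fin.
  (* For [n = 0] the convention that the inverse of 0 is 0 turns [K / n] into 0, which is at most
     [K]. *)
  have [->|n0] := posnP n; first by rewrite invr0 mulr0.
  by rewrite ler_pdivrMr ?ltr0n // ler_peMr // ler1n.
apply: (@squeeze_cvge _ _ _ _ (fun=> 0%E) _ (fun n => (K / n%:R)%:E)).
- by apply: nearW => n; rewrite depth_ge0 depth_le.
- exact: cvg_cst.
- apply: cvg_EFin; first by apply: nearW.
  rewrite -(mulr0 K); apply: cvgM; first exact: cvg_cst.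
  apply/gtr0_cvgV0; last exact: cvgr_idn.
  by exists 1%N => // n /=; rewrite ltr0n.
Qed.

Theorem proposition5p4 (R : realType) (D : R) (hD : 0 < D)
    (A B : 'rV[R]_3 -> R)
    (smoothA : smooth A) (smoothB : smooth B)
    (A_ge0 : forall x, 0 <= A x) (B_ge0 : forall x, 0 <= B x)
    (suppA : supported_in (cube D) A) (suppB : supported_in (cube D) B)
    (lambda : R) (hlambda : 0 < lambda) :
  exists S : BLR_sum D A B,
    [/\ shallow_wells S,
        (discrepancy D (alpha S) A <= (lambda * D)%:E)%E
      & (discrepancy D (beta S) B <= (lambda * D)%:E)%E].
Proof.
have discA := discrepancy_lifted_weight A hD hlambda.
have discB := discrepancy_lifted_weight B hD hlambda.
pose S := BLRSum (fun n i => ltW (lifted_weight_gt0 hD hlambda A_ge0 i))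
  (fun n i => ltW (lifted_weight_gt0 hD hlambda B_ge0 i))
  (le_lt_trans discA (ltry _)) (le_lt_trans discB (ltry _)).
exists S; split => //.
(* Smoothness at the empty list of derivatives is continuity of the function itself, hence
   boundedness on the compact cube. *)
have [MA hMA] := continuous_le_on_compact (@compact_cube R D) (smoothA [::]).1.
have [MB hMB] := continuous_le_on_compact (@compact_cube R D) (smoothB [::]).1.
have cubei n (i : box n) := center_in_cube i (ltW hD).
(* The lower constant is the shift alone; the larger of the two suprema bounds gives one upper
   constant for both families. *)
apply: (@shallow_wells_of_bounds _ _ _ _ _ (lambda * D)
  (Num.max MA MB * D ^+ 3 + lambda * D)) => //; first exact: mulr_gt0.
- move=> n i; rewrite lifted_weight_ge //=; apply: lifted_weight_le => //.
  by rewrite le_max hMA.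
- move=> n i; rewrite lifted_weight_ge //=; apply: lifted_weight_le => //.
  by rewrite le_max hMB ?orbT.
Qed.
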